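(* Let $d$ be an odd integer. If $E=\{k_j\}\subset\{0,1,\dots,d-1\}$ is such that the greatest common divisor of $d$ and $k_j-k_{j'}$ is $1$ for all distinct $k_j,k_{j'}\in E$, then the set $\{\mathbf 1_d,P_{k_j}\}_{k_j\in E}$ defines a set of mutually unbiased bases of $\mathbb C^d$.
   Context: Here $d$ is a positive odd integer, rows and columns of $d\times d$ matrices are indexed by $\{0,1,\dots,d-1\}$, and $q=\exp(2i\pi/d)$. $P_0$ is the matrix with entries $(P_0)_{j,k}=d^{-1/2}q^{jk}$, $D=\mathrm{diag}(1,q,q^3,\dots,q^{j(j+1)/2},\dots,1)$ for $j=0,\dots,d-1$, and $P_k:=D^{-k}P_0$ for $k\in\{0,\dots,d-1\}$. $\mathbf 1_d$ is the identity matrix. Two orthonormal bases $B,B'$ of $\mathbb C^d$ are mutually unbiased if $|b\cdot b'|=d^{-1/2}$ for all $b\in B$, $b'\in B'$. A unitary matrix defines the orthonormal basis formed by its columns; a set of unitary matrices defines a set of mutually unbiased bases if the bases defined by any two distinct members are mutually unbiased. *)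

(* Defs.v *)
From HB Require Import structures.
From mathcomp Require Import all_boot all_order all_algebra.
From mathcomp Require Import complex.
From mathcomp Require Import classical_sets reals sequences exp trigo.

Set Implicit Arguments.
Unset Strict Implicit.
Unset Printing Implicit Defensive.

Import Order.TTheory GRing.Theory Num.Theory.

Local Open Scope ring_scope.
Local Open Scope sesquilinear_scope.

Section Bases.
Variables (C : numClosedFieldType) (d : nat).

(* The Hermitian product on column vectors, antilinear in the first argument *)
Definition cdot (u v : 'cV[C]_d) : C := (u ^t* *m v) 0 0.

Definition orthonormal_basis (B : seq 'cV[C]_d) : Prop :=
  basis_of {:'cV[C]_d} B /\ {in B &, forall u v, cdot u v = (u == v)%:R}.

Definition mutually_unbiased (B B' : seq 'cV[C]_d) : Prop :=
  [/\ orthonormal_basis B, orthonormal_basis B' &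
      {in B & B', forall b b', `|cdot b b'| = (sqrtC d%:R)^-1}].

Definition columns (U : 'M[C]_d) : seq 'cV[C]_d := [seq col j U | j : 'I_d].

Definition defines_mub (S : set 'M[C]_d) : Prop :=
  (forall U, S U -> U \is unitarymx) /\
  (forall U V, S U -> S V -> U <> V ->
     mutually_unbiased (columns U) (columns V)).

End Bases.

Section Matrices.
Variables (R : realType) (d : nat).

Definition cexp (z : R[i]) : R[i] :=
  (expR (complex.Re z))%:C%C *
  (cos (complex.Im z) +i* sin (complex.Im z))%C.

Definition q : R[i] := cexp (2 * 'i%C * (pi : R)%:C%C / d%:R).

Definition P0 : 'M[R[i]]_d := \matrix_(j, k) ((sqrtC d%:R)^-1 * q ^+ (j * k)).

Definition D : 'M[R[i]]_d := diag_mx (\row_j q ^+ (j * j.+1)./2).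

Definition P (k : nat) : 'M[R[i]]_d := invmx (D ^+ k) *m P0.

End Matrices.

(* Main.v *)
(** The entry (l, l') of [(P k)^* (P k')] is [1/d] times the Gauss sum of
    [e j = z^(j(j+1)/2) * w^j], where [z = q^(k-k')] and [w = q^(l'-l)].  As [d]
    is odd, [e] has period [d], and [e (j+t) = e j * e t * z^(jt)].  Shifting the
    summation index in [|sum_j e j|^2] therefore gives
    [sum_t e t * sum_j (z^t)^j]; when [z] is a primitive [d]-th root of unity,
    only [t = 0] survives and the square of the modulus is [d].  For [k = k'] the
    sum is geometric, which yields unitarity. *)

Require Import Defs.
From mathcomp Require Import all_boot all_order all_algebra.
From mathcomp Require Import complex.
From mathcomp Require Import classical_sets reals.
From mathcomp Require Import exp trigo ring lra zify.

Import Order.TTheory GRing.Theory Num.Theory.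

Set Implicit Arguments.
Unset Strict Implicit.
Unset Printing Implicit Defensive.

Local Open Scope ring_scope.
Local Open Scope sesquilinear_scope.

Lemma triangularD (j t : nat) :
  (((j + t) * (j + t).+1)./2 = (j * j.+1)./2 + (t * t.+1)./2 + j * t)%N.
Proof.
have evenT n : ~~ odd (n * n.+1) by rewrite oddM /= andbN.
apply: double_inj; rewrite !doubleD !even_halfK //; lia.
Qed.

Lemma diag_mxX (R : pzSemiRingType) d n (v : 'rV[R]_d) :
  diag_mx v ^+ n = diag_mx (\row_j v 0 j ^+ n).
Proof.
elim: n => [|n IH].
  by rewrite expr0; apply/matrixP => i j; rewrite !mxE.
rewrite exprS IH -[_ * _]/(_ *m _) mulmx_diag; congr diag_mx.
by apply/rowP => j; rewrite !mxE exprS.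
Qed.

(** * Roots of unity and the quadratic Gauss sum *)

Section RootsOfUnity.
Variable C : numClosedFieldType.
Implicit Types z w : C.

Lemma norm_root1 z n : (0 < n)%N -> z ^+ n = 1 -> `|z| = 1.
Proof.
by move=> n_gt0 zn1; apply/eqP; rewrite -(pexpr_eq1 n_gt0) // -normrX zn1 normr1.
Qed.

Lemma sum_root1 z n : z ^+ n = 1 -> \sum_(i < n) z ^+ i = (n * (z == 1))%:R.
Proof.
move=> zn1; case: eqVneq => [->|z1].
  rewrite muln1 (eq_bigr (fun=> 1)) => [|i _]; last by rewrite expr1n.
  by rewrite sumr_const card_ord.
rewrite muln0; apply/eqP; move/eqP: zn1; rewrite -subr_eq0 subrX1 mulf_eq0.
by rewrite subr_eq0 (negPf z1).
Qed.

(** Moving the start of the window by one drops [e k] and gains [e (k + n)], which are equal by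
    periodicity. *)
Lemma reindex_period n (e : nat -> C) (k : nat) :
    (forall j, e (j + n)%N = e j) ->
  \sum_(j < n) e j = \sum_(t < n) e (k + t)%N.
Proof.
move=> per; elim: k => [//|k ->]; case: n per => [|n] per; first by rewrite !big_ord0.
rewrite big_ord_recl [RHS]big_ord_recr /= addn0 [RHS]addrC; congr (_ + _).
  by rewrite addSnnS per.
by apply: eq_bigr => i _; rewrite addSnnS.
Qed.

Lemma norm_gauss_sum n z w : odd n -> n.-primitive_root z -> w ^+ n = 1 ->
  `|\sum_(j < n) z ^+ (j * j.+1)./2 * w ^+ j| = sqrtC n%:R.
Proof.
move=> n_odd prim_z wn1; have n_gt0 := odd_gt0 n_odd.
pose e j := z ^+ (j * j.+1)./2 * w ^+ j.
have zn1 := prim_expr_order prim_z.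
have eD j t : e (j + t)%N = e j * e t * z ^+ (j * t).
  by rewrite /e triangularD !exprD; ring.
(* Oddness enters here: [n.+1./2] is then exactly half of [n.+1], so [n] divides the exponent of
   [z]. For even [n] the power of [z] would be -1. *)
have en1 : e n = 1.
  rewrite /e wn1 mulr1; apply/eqP; rewrite -(prim_order_dvd prim_z).
  have -> : ((n * n.+1)./2 = n * n.+1./2)%N.
    by apply: double_inj; rewrite doubleMr !even_halfK //= ?oddM /= n_odd.
  exact: dvdn_mulr.
have per j : e (j + n)%N = e j.
  by rewrite eD en1 mulr1 mulnC exprM zn1 expr1n mulr1.
have norm_e j : `|e j| = 1.
  by rewrite normrM !normrX (norm_root1 n_gt0 zn1) (norm_root1 n_gt0 wn1)
             !expr1n mulr1.
rewrite -[LHS]sqrCK // normCK rmorph_sum mulr_sumr; congr sqrtC.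
(* The sum multiplied by the conjugate of [e k] is started at [k]: each [e (k + t)] then has a
   factor [e k], which cancels against that conjugate. *)
under eq_bigr => k _ do rewrite (reindex_period k per) mulr_suml.
transitivity (\sum_(k < n) \sum_(t < n) e t * (z ^+ t) ^+ k).
  apply: eq_bigr => k _; apply: eq_bigr => t _.
  rewrite eD -exprM [(t * k)%N]mulnC mulrAC [e k * e t]mulrC -[_ * _ * _^*]mulrA.
  by rewrite -normCK norm_e expr1n mulr1.
rewrite exchange_big /=; under eq_bigr => t _.
  rewrite -mulr_sumr sum_root1; last by rewrite exprAC zn1 expr1n.
  rewrite -(prim_order_dvd prim_z); over.
rewrite (bigD1 (Ordinal n_gt0)) //= big1 ?addr0 => [|t t0].
  by rewrite /e dvdn0 !muln1 !expr0 !mul1r.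
by rewrite gtnNdvd ?ltn_ord ?muln0 ?mulr0 // lt0n; exact: t0.
Qed.

End RootsOfUnity.

(** * Unitary matrices and the bases of their columns *)

Section UnitaryBases.
Variables (C : numClosedFieldType) (d : nat).
Implicit Types U V : 'M[C]_d.

Lemma cdotE (u v : 'cV[C]_d) : cdot u v = \sum_i (u i 0)^* * v i 0.
Proof. by rewrite /cdot mxE; apply: eq_bigr => i _; rewrite !mxE. Qed.

Lemma adjmxE U i j : (U ^t* ) i j = (U j i)^*.
Proof. by rewrite !mxE. Qed.

Lemma cdot_col U V i j : cdot (col i U) (col j V) = (U ^t* *m V) i j.
Proof. by rewrite cdotE mxE; apply: eq_bigr => k _; rewrite !mxE. Qed.

Lemma cdot_conj (u v : 'cV[C]_d) : cdot u v = (cdot v u)^*.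
Proof.
rewrite !cdotE rmorph_sum; apply: eq_bigr => i _.
by rewrite rmorphM /= conjCK mulrC.
Qed.

Lemma trmxC1 : (1%:M : 'M[C]_d) ^t* = 1%:M.
Proof. by rewrite trmx1 map_mx1. Qed.

Lemma unitarymx_adjK U : U \is unitarymx -> U ^t* *m U = 1%:M.
Proof. by move/unitarymxP/mulmx1C. Qed.

Lemma orthonormal_columns U : U \is unitarymx -> orthonormal_basis (columns U).
Proof.
move=> uU; have UU := unitarymx_adjK uU; split.
  rewrite basisEdim size_map size_enum_ord dimvf; apply/andP; split.
    apply/subvP => v _.
    (* The coordinates of [v] come from [v = U (U^* v)]; [d] spanning vectors in dimension [d] form
       a basis. *)
    have -> : v = \sum_j (U ^t* *m v) j 0 *: col j U.
      rewrite -{1}[v]mul1mx -(unitarymxP uU) -mulmxA.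
      apply/colP => i; rewrite mxE summxE; apply: eq_bigr => j _.
      by rewrite [RHS]mxE [in RHS](mxE _ _ i) mulrC.
    apply: memv_suml => j _; apply/memvZ/memv_span/map_f.
    by rewrite mem_enum.
  by rewrite /dim /= muln1.
move=> _ _ /mapP[i _ ->] /mapP[j _ ->]; rewrite cdot_col UU mxE.
case: eqVneq => [->|ij]; first by rewrite eqxx.
(* Orthonormality compares vectors, the product [U^* U] compares indices. Equal columns at distinct
   indices would make an off-diagonal 0 equal to a diagonal 1. *)
case: eqP => // eqU; have := congr1 (fun A : 'M_d => A i i) UU.
rewrite -cdot_col {2}eqU cdot_col UU !mxE eqxx (negPf ij) => /eqP.
by rewrite eq_sym oner_eq0.
Qed.

Lemma mutually_unbiased_unitary U V :
    U \is unitarymx -> V \is unitarymx ->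
    (forall i j, `|(U ^t* *m V) i j| = (sqrtC d%:R)^-1) ->
  mutually_unbiased (columns U) (columns V).
Proof.
move=> uU uV normUV; split; [exact: orthonormal_columns.. |].
by move=> _ _ /mapP[i _ ->] /mapP[j _ ->]; rewrite cdot_col.
Qed.

Lemma mutually_unbiased_sym (B B' : seq 'cV[C]_d) :
  mutually_unbiased B B' -> mutually_unbiased B' B.
Proof.
case=> oB oB' BB'; split=> // b b' bB b'B'.
by rewrite cdot_conj norm_conjC BB'.
Qed.

End UnitaryBases.

(** * The root [q] and the matrices [P k] *)

Section Roots.
Variables (R : realType) (d : nat).
Hypothesis d_gt0 : (0 < d)%N.

Let theta : R := 2 * pi / d%:R.

Lemma qE : q R d = (cos theta +i* sin theta)%C.
Proof.
rewrite /q; have -> : 2 * 'i%C * (pi : R)%:C%C / d%:R = (0 +i* theta)%C.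
  rewrite -(rmorph_nat (real_complex R) d) -fmorphV -(rmorph_nat (real_complex R) 2).
  by simpc.
by rewrite /cexp /= expR0 mul1r.
Qed.

Lemma qX n : q R d ^+ n = (cos (theta *+ n) +i* sin (theta *+ n))%C.
Proof.
elim: n => [|n IH]; first by rewrite mulr0n cos0 sin0.
rewrite exprS IH qE mulrS cosD sinD; simpc.
by congr (_ +i* _)%C; rewrite addrC.
Qed.

Lemma q_prim : d.-primitive_root (q R d).
Proof.
rewrite /primitive_root_of_unity d_gt0; apply/forallP => i.
rewrite unity_rootE qX; apply/eqP.
have d_neq0 : (d%:R : R) != 0 by rewrite pnatr_eq0 -lt0n.
case: (eqVneq i.+1 d) => [->|id].
  have -> : theta *+ d = pi *+ 2.
    by rewrite -mulr_natr /theta mulfVK // mulr_natl.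
  by rewrite cos2pi sin2pi; exact: eqxx.
have lt_id : (i.+1 < d)%N by rewrite ltn_neqAle id ltn_ord.
apply/negbTE/eqP => -[cos1 _].
(* Half the argument of [q ^+ i.+1]: it lies strictly between 0 and pi, so its sine is positive,
   whereas [cos (2x) = 1] would force [sin x = 0]. *)
pose x : R := pi * (i.+1%:R / d%:R).
have thx : theta *+ i.+1 = x *+ 2.
  by rewrite -[LHS]mulr_natr -[RHS]mulr_natr /theta /x; ring.
have sin_x : 0 < sin x.
  apply: sin_gt0_pi; rewrite mulr_gt0 ?pi_gt0 ?divr_gt0 ?ltr0n //=.
  by rewrite -[ltRHS]mulr1 ltr_pM2l ?pi_gt0 // ltr_pdivrMr ?ltr0n // mul1r ltr_nat.
move: cos1; rewrite thx cos_mulr2n cos2sin2 => cos1.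
have : sin x ^+ 2 = 0 by lra.
by move/eqP; rewrite expf_eq0 /= gt_eqF.
Qed.

Lemma q_expd : q R d ^+ d = 1. Proof. exact: prim_expr_order q_prim. Qed.

Lemma norm_q : `|q R d| = 1. Proof. exact: norm_root1 d_gt0 q_expd. Qed.

Lemma q_neq0 : q R d != 0. Proof. by rewrite -normr_gt0 norm_q. Qed.

Lemma conj_q : (q R d)^* = (q R d)^-1.
Proof. by rewrite invC_norm norm_q expr1n invr1 mul1r. Qed.

Lemma P_entry k (j l : 'I_d) :
  P R d k j l = (sqrtC d%:R)^-1 * (q R d ^- ((j * j.+1)./2 * k) * q R d ^+ (j * l)).
Proof.
pose v n := \row_(j < d) (q R d ^+ (j * j.+1)./2) ^+ n.
have Dk : D R d ^+ k = diag_mx (v k).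
  by rewrite diag_mxX; congr diag_mx; apply/rowP => i; rewrite !mxE.
have Dunit : D R d ^+ k \in unitmx.
  rewrite Dk unitmxE det_diag unitfE; apply/prodf_neq0 => i _.
  by rewrite mxE !expf_neq0 ?q_neq0.
suff -> : P R d k = \matrix_(j, l) ((sqrtC d%:R)^-1 *
    (q R d ^- ((j * j.+1)./2 * k) * q R d ^+ (j * l))) by rewrite mxE.
(* Multiplying both sides by the invertible [D ^+ k] avoids computing its inverse. *)
apply: (can_inj (mulKmx Dunit)); rewrite mulKVmx // Dk mul_diag_mx.
apply/matrixP => a b; rewrite !mxE -exprM mulrCA; congr (_ * _).
by rewrite mulVKf // expf_neq0 // q_neq0.
Qed.

(* The exponents k + (d - k') and l' + (d - l) stand for k - k' and l' - l mod d. *)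
Lemma adjP_mul k k' (l l' : 'I_d) : (k' <= d)%N ->
  ((P R d k) ^t* *m P R d k') l l' =
  d%:R^-1 * \sum_(j < d) (q R d ^+ (k + (d - k'))) ^+ (j * j.+1)./2
                        * (q R d ^+ (l' + (d - l))) ^+ j.
Proof.
move=> k'd; rewrite mxE mulr_sumr; apply: eq_bigr => j _; rewrite adjmxE !P_entry.
have qB m : (m <= d)%N -> q R d ^+ (d - m) = q R d ^- m.
  by move=> md; rewrite -[RHS]mul1r -q_expd expfB_cond // (negPf q_neq0) add0n.
rewrite !rmorphM !fmorphV !rmorphXn /= conj_q !exprD !qB ?(ltnW (ltn_ord l)) //.
have -> : (sqrtC (d%:R : R[i]))^* = sqrtC d%:R.
  by apply/CrealP/ger0_real; rewrite sqrtC_ge0 ler0n.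
rewrite -[in RHS](sqrtCK d%:R).
(* exprMn would otherwise unfold q. *)
move: (q R d) => x.
rewrite !exprMn !exprVn invrK -!exprM.
rewrite [(k * _)%N]mulnC [(k' * _)%N]mulnC [(l' * _)%N]mulnC [(l * _)%N]mulnC.
by rewrite expr2 invfM; ring.
Qed.

Lemma P_unitary k : (k <= d)%N -> P R d k \is unitarymx.
Proof.
move=> kd; apply/unitarymxP/mulmx1C/matrixP => l l'.
rewrite adjP_mul // subnKC // q_expd.
under eq_bigr => j _ do rewrite expr1n mul1r.
rewrite sum_root1; last by rewrite exprAC q_expd expr1n.
rewrite mxE natrM mulKf ?pnatr_eq0 -?lt0n // -(prim_order_dvd q_prim).
(* The geometric sum survives iff [l'] and [l] agree modulo [d], that is, iff they are equal. *)
rewrite addnBA 1?ltnW // -eqn_mod_dvd; last by rewrite ltnW // ltn_addl.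
by rewrite modnDr !modn_small // eq_sym.
Qed.

(** Coprimality keeps [q ^+ (k + (d - k'))] a primitive [d]-th root, so the Gauss sum has modulus
    [sqrtC d] and dividing it by [d] leaves the inverse of [sqrtC d]. *)
Lemma P_unbiased k k' : odd d -> (k <= d)%N -> (k' <= d)%N ->
    coprime (k + (d - k')) d ->
  mutually_unbiased (columns (P R d k)) (columns (P R d k')).
Proof.
move=> d_odd kd k'd co; apply: mutually_unbiased_unitary; try exact: P_unitary.
move=> l l'; rewrite adjP_mul // normrM norm_gauss_sum //; first last.
- by rewrite exprAC q_expd expr1n.
- by rewrite (prim_root_exp_coprime _ q_prim).
rewrite normfV normr_nat -{1}[d%:R]sqrtCK expr2 invfM mulfVK //.
by rewrite sqrtC_eq0 pnatr_eq0 -lt0n.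
Qed.

Lemma id_P_unbiased k : (k <= d)%N ->
  mutually_unbiased (columns 1%:M) (columns (P R d k)).
Proof.
move=> kd; apply: mutually_unbiased_unitary; last first.
- move=> i j; rewrite trmxC1 mul1mx P_entry !normrM !normfV !normrX norm_q.
  by rewrite !expr1n invr1 !mulr1 ger0_norm // sqrtC_ge0 ler0n.
- exact: P_unitary.
- by apply/unitarymxP; rewrite trmxC1 mulmx1.
Qed.

End Roots.

Theorem proposition2p17 (R : realType) (d : nat) (E : {set 'I_d}) :
  odd d ->
  (forall k k' : 'I_d, k \in E -> k' \in E -> k <> k' ->
     gcdz d%:Z (k%:Z - k'%:Z) = 1) ->
  defines_mub ([set 1%:M] `|` [set P R d (nat_of_ord k) | k in [set` E]])%classic.
Proof.
move=> d_odd co; have d_gt0 := odd_gt0 d_odd.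
have le_d (k : 'I_d) : (k <= d)%N := ltnW (ltn_ord k).
split=> [U [->|[k _ <-]]|U V [->|[k kE <-]] [->|[k' k'E <-]] neqUV] //.
- by apply/unitarymxP; rewrite trmxC1 mulmx1.
- exact: P_unitary.
- exact: id_P_unbiased.
- exact/mutually_unbiased_sym/id_P_unbiased.
apply: P_unbiased => //.
have /(co k k' kE k'E) : k <> k' by move=> kk'; apply: neqUV; rewrite kk'.
(* Adding [d] to the difference keeps the gcd and makes the exponent a natural number. *)
have -> : gcdz d (k%:Z - k'%:Z) = gcdz d (k + (d - k'))%N.
  rewrite -(gcdzMDl 1) mul1r; congr (gcdz _ _).
  by rewrite PoszD -subzn //; ring.
by case=> gcd1; rewrite /coprime gcdnC; apply/eqP.
Qed.
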